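(* Let $G=(V,E,\mathbf{w})$ be a finite simple graph with non-negative edge weights. If $G$ is split-decomposable and has a skeleton $\mathcal{S}$ such that $\mathcal{S}$ is exact, then $G$ is exact.
   Context: Given a weighted graph $G=(V,E,\mathbf{w})$ on $n$ vertices and integers $p_i\ge1$, $i\in[n]=\{1,\dots,n\}$, the vertex-split graph $\widetilde{G}$ is obtained by replacing each vertex $i$ with $p_i$ distinct copies; for each edge $ij\in E$ all possible edges are added between the copies of $i$ and the copies of $j$, each with weight $w_{ij}/(p_ip_j)$, where $w_{ij}$ is the weight of $ij$ (there are no edges among copies of the same vertex). Taking all $p_i=1$ shows $G$ is a vertex-split graph of itself. A weighted graph $G$ is split-decomposable with skeleton $\mathcal{S}$, where $\mathcal{S}$ is a graph all of whose edges have the same weight $w$, if there exists a vertex-split graph $\widetilde{G}$ of $G$ such that: (1) $\widetilde{G}$ contains a uniformly weighted spanning subgraph $\mathcal{S}'$ (with edge weights inherited from $\widetilde{G}$) that is isomorphic, as a weighted graph, to the vertex-split graph of $\mathcal{S}$ obtained by replacing each vertex of $\mathcal{S}$ by the same number $p\ge2$ of copies (so every edge of $\mathcal{S}'$ has weight $w/p^2$); (2) the residual edges, i.e. those in $E(\widetilde{G})\setminus E(\mathcal{S}')$, are contained entirely within the vertex sets corresponding to the copies of a single vertex of $\mathcal{S}$ (each residual edge joins two copies of one and the same vertex of $\mathcal{S}$), and each such edge has weight at most $w/p^2$. The Laplacian $\mathcal{L}_G$ of a graph $G=(V,E)$ with edge weights $w_{ij}$ ($w_{ij}=0$ for non-edges)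 is the $V\times V$ matrix with off-diagonal entries $-w_{ij}$ and diagonal entries $\sum_{j\ne i}w_{ij}$. The MAXCUT SDP of $G$ is: maximize $\frac14\langle \mathcal{L}_G,\mathbf{X}\rangle$ over symmetric matrices $\mathbf{X}\in\mathbb{R}^{V\times V}$ with $X_{ii}=1$ for all $i\in V$ and $\mathbf{X}\succeq \mathbf{0}$ (positive semidefinite), where $\langle \mathbf{A},\mathbf{B}\rangle=\operatorname{tr}(\mathbf{A}\mathbf{B})$. $\mathrm{MAXCUT}(G)$ is the maximum, over partitions $(S,V\setminus S)$ of $V$, of the total weight of edges with exactly one endpoint in $S$. A graph $G$ is called exact if the optimal value of the MAXCUT SDP of $G$ equals $\mathrm{MAXCUT}(G)$; equivalently, if the MAXCUT SDP has an optimal solution of rank $1$.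
   Formalization: Added hypothesis: residual edges occur only among copies of a vertex of the skeleton that has a neighbour in the skeleton; without it the claim fails, e.g. for K_{3,3} plus a disjoint triangle (unit weights) with skeleton K_2 (weight 9) plus K_1 and p = 3. *)

(* Defs.v *)
From HB Require Import structures.
From mathcomp Require Import all_boot all_order all_algebra.
From mathcomp Require Import boolp classical_sets reals.

Set Implicit Arguments.
Unset Strict Implicit.
Unset Printing Implicit Defensive.

Import Order.TTheory GRing.Theory Num.Theory.

Local Open Scope ring_scope.

(* Edges are explicit data, so an edge may have weight 0; off the edges the
   weight is 0 by convention, so that sums may range over all pairs. *)
Record wgraph (R : realType) (V : finType) := WGraph {
  edge : rel V;
  weight : V -> V -> R;
  edge_sym : symmetric edge;
  edge_irr : irreflexive edge;
  weight_sym : forall u v, weight u v = weight v u;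
  weight_nonedge : forall u v, ~~ edge u v -> weight u v = 0 }.

Definition nonneg_weights (R : realType) (V : finType) (G : wgraph R V) :=
  forall u v, edge G u v -> 0 <= weight G u v.

Section Split.
Variables (R : realType) (V : finType) (G : wgraph R V) (m : V -> nat).

(* The vertex (i, k) is the k-th of the m i copies of i. *)
Definition split_vertex : finType := {i : V & 'I_(m i)}.

Definition split_edge : rel split_vertex :=
  fun a b => edge G (tag a) (tag b).

Definition split_weight (a b : split_vertex) : R :=
  weight G (tag a) (tag b) / ((m (tag a))%:R * (m (tag b))%:R).

Fact split_edge_sym : symmetric split_edge.
Proof. by move=> a b; rewrite /split_edge edge_sym. Qed.

Fact split_edge_irr : irreflexive split_edge.
Proof. by move=> a; rewrite /split_edge edge_irr. Qed.

Fact split_weight_sym a b : split_weight a b = split_weight b a.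
Proof. by rewrite /split_weight weight_sym [X in _ / X]mulrC. Qed.

Fact split_weight_nonedge a b : ~~ split_edge a b -> split_weight a b = 0.
Proof. by move=> nab; rewrite /split_weight weight_nonedge ?mul0r. Qed.

Definition split_graph : wgraph R split_vertex :=
  WGraph split_edge_sym split_edge_irr split_weight_sym split_weight_nonedge.

End Split.

Definition spanning_subgraph (R : realType) (V : finType) (H G : wgraph R V) :=
  forall u v, edge H u v -> edge G u v /\ weight H u v = weight G u v.

Definition wgraph_iso (R : realType) (V W : finType)
    (G : wgraph R V) (H : wgraph R W) (g : V -> W) :=
  [/\ bijective g,
      forall u v, edge H (g u) (g v) = edge G u v &
      forall u v, weight H (g u) (g v) = weight G u v].

Definition residual (R : realType) (V : finType) (G H : wgraph R V) : rel V :=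
  fun u v => edge G u v && ~~ edge H u v.

(* An inhabitant witnesses that G is split-decomposable with skeleton S.
   Here sd_graph is the spanning subgraph S' of the vertex-split graph of G,
   and sd_iso identifies it with the p-fold uniform split of S; since sd_iso is
   onto, the last two fields range over all residual edges. *)
Record split_decomposition (R : realType) (V U : finType)
    (G : wgraph R V) (S : wgraph R U) := SplitDecomposition {
  sd_w : R;
  sd_mult : V -> nat;
  sd_p : nat;
  sd_graph : wgraph R (split_vertex sd_mult);
  sd_iso : split_vertex (fun _ : U => sd_p) -> split_vertex sd_mult;
  sd_uniform : forall s t, edge S s t -> weight S s t = sd_w;
  sd_mult_gt0 : forall i, (0 < sd_mult i)%N;
  sd_p_ge2 : (2 <= sd_p)%N;
  sd_spanning : spanning_subgraph sd_graph (split_graph G sd_mult);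
  sd_isoP : wgraph_iso (split_graph S (fun _ => sd_p)) sd_graph sd_iso;
  sd_residual_block : forall a b,
    residual (split_graph G sd_mult) sd_graph (sd_iso a) (sd_iso b) ->
    tag a = tag b;
  sd_residual_weight : forall a b,
    residual (split_graph G sd_mult) sd_graph (sd_iso a) (sd_iso b) ->
    weight (split_graph G sd_mult) (sd_iso a) (sd_iso b)
      <= sd_w / sd_p%:R ^+ 2 }.

Arguments sd_w {R V U G S} D : rename.
Arguments sd_mult {R V U G S} D i : rename.
Arguments sd_p {R V U G S} D : rename.
Arguments sd_graph {R V U G S} D : rename.
Arguments sd_iso {R V U G S} D a : rename.

(* Residual edges only occur among copies of non-isolated vertices of S (for
   instance, because S has no isolated vertex). At an isolated vertex of S the
   other conditions do not force exactness: with p = 3, the disjoint union of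
   K_{3,3} and K_3 with unit weights has the disjoint union of K_2 (of weight 9)
   and K_1 as a skeleton, which is bipartite, hence exact, while the triangle
   has SDP value 9/4 and maximum cut 2. *)
Definition residual_nonisolated (R : realType) (V U : finType)
    (G : wgraph R V) (S : wgraph R U) (D : split_decomposition G S) :=
  forall a b,
    residual (split_graph G (sd_mult D)) (sd_graph D)
             (sd_iso D a) (sd_iso D b) ->
    exists t, edge S (tag a) t.

Definition psd (R : realType) (n : nat) (X : 'M[R]_n) :=
  forall v : 'cV[R]_n, 0 <= (v^T *m X *m v) 0 0.

Section MaxCut.
Variables (R : realType) (V : finType) (G : wgraph R V).

(* V x V matrices are indexed through the enumeration enum_val of V. *)
Definition laplacian : 'M[R]_#|V| :=
  \matrix_(i, j)
    if i == j then \sum_(k | k != i) weight G (enum_val i) (enum_val k)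
    else - weight G (enum_val i) (enum_val j).

Definition sdp_feasible (X : 'M[R]_#|V|) :=
  [/\ X^T = X, forall i, X i i = 1 & psd X].

Definition sdp_objective (X : 'M[R]_#|V|) : R :=
  4^-1 * \tr (laplacian *m X).

(* The supremum is attained: the feasible set is non-empty and compact. *)
Definition sdp_value : R :=
  sup [set sdp_objective X | X in sdp_feasible]%classic.

Definition cut_weight (A : {set V}) : R :=
  \sum_(u in A) \sum_(v in ~: A) weight G u v.

(* The default value 0 is the weight of the empty cut. *)
Definition maxcut : R := \big[Num.max/0]_(A : {set V}) cut_weight A.

Definition exact := sdp_value = maxcut.

End MaxCut.

(* Main.v *)
Require Import Defs.
From mathcomp Require Import all_boot all_order all_algebra.
From mathcomp Require Import boolp classical_sets reals.
From mathcomp Require Import ring lra.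

(** The SDP is treated through positive semidefinite kernels K on the vertices,
    with objective energy G K = 1/4 * sum_(u, v) w_uv * (1 - K u v); exactness
    says that no correlation kernel (diagonal 1) has energy above the maximum
    cut (exact_energyP).

    Let K be a correlation kernel for G.  Lift it to the vertex-split graph:
    all copies of a vertex get the same vector, and the weights w_ij / (p_i p_j)
    are such that the energy does not change (energy_split).  Transport it to
    the p-fold split of the skeleton S and average over the p copies of each
    vertex; this gives a psd kernel Y on S with diagonal at most 1.  The
    skeleton part contributes exactly energy S Y.  A residual edge joins two
    copies of one vertex s, and its weight is at most w / p^2; all pairs of
    copies of s together contribute at most w * (1 - Y s s) / 4
    (decomposition_energy_le).  Since such an s is not isolated in S, it
    remains to bound

      energy S Y + 1/4 * sum_(s not isolated) w * (1 - Y s s)  <=  maxcut S.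

    This is where exactness of S is used (exact_uniform_slack).  Let x be the
    sign vector of a maximum cut of S, and let q_s be the weight at s of the cut
    edges minus that of the uncut edges (cut_excess).  Exactness makes x x^T
    optimal among correlations, and moving from x x^T a small amount in the
    direction of an arbitrary psd kernel Y gives (local_optimality)

      sum_(s, t) w_st * Y s t + sum_s q_s * Y s s  >=  0,

    which is the dual certificate that diag(q) + (w_st) is psd.  Its diagonal
    entry q_s cannot be <= 0 when its row contains a positive w_st
    (cut_excess_gt0); and since all weights equal w, q_s is an integer multiple
    of w, hence q_s >= w (cut_excess_ge_weight).  That integrality gap absorbs
    the residual term.

    Finally maxcut S <= maxcut G: a cut of S lifts to the split graph of G
    without loss because residual edges have non-negative weight, and a cut of
    a split graph averages to a vector in [-1, 1]^V, which rounds to a cut of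
    at least the same weight because the energy is affine in each coordinate
    (energy_rank1_le_maxcut). *)

Set Implicit Arguments.
Unset Strict Implicit.
Unset Printing Implicit Defensive.

Import Order.TTheory GRing.Theory Num.Theory.

Local Open Scope ring_scope.

Definition energy (R : realType) (V : finType) (G : wgraph R V)
    (K : V -> V -> R) : R :=
  4^-1 * \sum_u \sum_v weight G u v * (1 - K u v).

Definition psd_kernel (R : realType) (V : finType) (K : V -> V -> R) :=
  (forall u v, K u v = K v u) /\
  forall f : V -> R, 0 <= \sum_u \sum_v f u * K u v * f v.

Definition correlation (R : realType) (V : finType) (K : V -> V -> R) :=
  psd_kernel K /\ forall u, K u u = 1.

Definition rank1 (R : realType) (V : finType) (f : V -> R) (u v : V) : R :=
  f u * f v.

Definition sign_vector (R : realType) (V : finType) (A : {set V}) (u : V) : R :=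
  (-1) ^+ (u \in A).

(** * Positive semidefinite kernels *)

Section Kernels.
Variables (R : realType) (V : finType).
Implicit Types (K L : V -> V -> R) (f : V -> R).

Lemma psd_rank1 f : psd_kernel (rank1 f).
Proof.
split=> [u v|g]; first by rewrite /rank1 mulrC.
suff -> : \sum_u \sum_v g u * rank1 f u v * g v = (\sum_u g u * f u) ^+ 2.
  exact: sqr_ge0.
rewrite expr2 big_distrlr; apply: eq_bigr => u _; apply: eq_bigr => v _.
by rewrite /rank1 /=; ring.
Qed.

Lemma psd_add K L :
  psd_kernel K -> psd_kernel L -> psd_kernel (fun u v => K u v + L u v).
Proof.
move=> [symK posK] [symL posL]; split=> [u v|f]; first by rewrite symK symL.
suff -> : \sum_u \sum_v f u * (K u v + L u v) * f v =
    \sum_u \sum_v f u * K u v * f v + \sum_u \sum_v f u * L u v * f v.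
  exact: addr_ge0.
rewrite -big_split; apply: eq_bigr => u _ /=; rewrite -big_split.
by apply: eq_bigr => v _ /=; ring.
Qed.

Lemma psd_scale a K : 0 <= a -> psd_kernel K -> psd_kernel (fun u v => a * K u v).
Proof.
move=> a0 [symK posK]; split=> [u v|f]; first by rewrite symK.
suff -> : \sum_u \sum_v f u * (a * K u v) * f v =
    a * \sum_u \sum_v f u * K u v * f v by exact: mulr_ge0.
rewrite mulr_sumr; apply: eq_bigr => u _; rewrite mulr_sumr.
by apply: eq_bigr => v _; ring.
Qed.

(** The quadratic form at f is that of K at the push-forward of f along h, so no
    Gram vectors are needed; with I the set of copies, this covers both the
    pull-back to a split graph and the averaging over copies. *)
Lemma psd_block_sum (W I : finType) (h : W -> I -> V) K :
  psd_kernel K -> psd_kernel (fun a b => \sum_i \sum_j K (h a i) (h b j)).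
Proof.
move=> [symK posK]; split=> [a b|f].
  by rewrite exchange_big; apply: eq_bigr => i _; apply: eq_bigr => j _.
pose F u := \sum_a \sum_i (h a i == u)%:R * f a.
have pushF H : \sum_u F u * H u = \sum_a \sum_i f a * H (h a i).
  rewrite /F; under eq_bigr => u _ do rewrite mulr_suml.
  rewrite exchange_big; apply: eq_bigr => a _ /=.
  under eq_bigr => u _ do rewrite mulr_suml.
  rewrite exchange_big; apply: eq_bigr => i _ /=.
  rewrite (bigD1 (h a i)) //= eqxx mul1r big1 ?addr0 // => u /negPf nu.
  by rewrite eq_sym nu !mul0r.
suff -> : \sum_a \sum_b f a * (\sum_i \sum_j K (h a i) (h b j)) * f b =
    \sum_u \sum_v F u * K u v * F v by exact: posK.
have -> : \sum_u \sum_v F u * K u v * F v = \sum_u F u * \sum_v F v * K u v.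
  apply: eq_bigr => u _; rewrite mulr_sumr.
  by apply: eq_bigr => v _; ring.
rewrite pushF; apply: eq_bigr => a _.
under [RHS]eq_bigr => i _ do rewrite pushF mulr_sumr.
rewrite exchange_big /=; apply: eq_bigr => b _.
rewrite mulr_sumr mulr_suml; apply: eq_bigr => i _.
rewrite !mulr_sumr mulr_suml; apply: eq_bigr => j _; ring.
Qed.

Lemma psd_ge0 K u : psd_kernel K -> 0 <= K u u.
Proof.
move=> [_ /(_ (fun w => (w == u)%:R))].
rewrite (bigD1 u) //= [X in _ + X]big1 ?addr0; last first.
  by move=> w /negPf ->; rewrite big1 // => v _; rewrite !mul0r.
rewrite (bigD1 u) //= big1 ?addr0 ?eqxx ?mul1r ?mulr1 //.
by move=> w /negPf ->; rewrite mulr0.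
Qed.

Lemma correlation_bounded K u v : correlation K -> -1 <= K u v <= 1.
Proof.
move=> [psdK diagK].
have [symK _] := psdK.
have two (e : R) : 0 <= K u u + e * e * K v v + e * (K u v + K v u).
  have [_ posK] := psdK.
  (* The quadratic form of K at the vector e_u + e * e_v. *)
  have [euv|nuv] := eqVneq u v.
    subst v; rewrite !diagK; have := sqr_ge0 (1 + e); nra.
  have := posK (fun w => (w == u)%:R + e * (w == v)%:R).
  have pick (H : V -> R) :
      \sum_w ((w == u)%:R + e * (w == v)%:R) * H w = H u + e * H v.
    rewrite (bigD1 u) //= (bigD1 v) 1?eq_sym //= big1; last first.
      by move=> w /andP[/negPf -> /negPf ->]; rewrite mulr0 addr0 mul0r.
    by rewrite !eqxx [v == u]eq_sym (negPf nuv) /=; ring.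
  under eq_bigr => w _ do under eq_bigr => z _ do rewrite -mulrA.
  under eq_bigr => w _ do rewrite -mulr_sumr.
  rewrite pick.
  under eq_bigr => w _ do rewrite mulrC.
  rewrite pick; under eq_bigr => w _ do rewrite mulrC.
  by rewrite pick; lra.
have := two 1; have := two (-1); rewrite !diagK (symK v u); lra.
Qed.

End Kernels.

(** * Energy, cuts and rounding *)

Section Energy.
Variables (R : realType) (V : finType) (G : wgraph R V).
Implicit Types (K : V -> V -> R).

Lemma weight_irr u : weight G u u = 0.
Proof. by apply: weight_nonedge; rewrite edge_irr. Qed.

Lemma energy_sign_vector (A : {set V}) :
  energy G (rank1 (sign_vector R A)) = cut_weight G A.
Proof.
have half (f : V -> V -> R) : \sum_u \sum_v f u v =
    \sum_(u in A) \sum_(v in A) f u v + \sum_(u in A) \sum_(v in ~: A) f u v +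
   (\sum_(u in ~: A) \sum_(v in A) f u v
    + \sum_(u in ~: A) \sum_(v in ~: A) f u v).
  have sp (g : V -> R) : \sum_v g v = \sum_(v in A) g v + \sum_(v in ~: A) g v.
    rewrite (bigID (mem A)) /=; congr (_ + _).
    by apply: eq_bigl => v; rewrite inE.
  by rewrite sp -!big_split /=; congr (_ + _); apply: eq_bigr => u _; rewrite sp.
rewrite /energy half /rank1 /sign_vector.
rewrite [X in X + _ + _]big1; last first.
  move=> u uA; apply: big1 => v vA; rewrite uA vA; ring.
rewrite [X in _ + (_ + X)]big1; last first.
  move=> u; rewrite inE => /negPf uA; apply: big1 => v.
  rewrite inE => /negPf vA; rewrite uA vA; ring.
have -> : \sum_(u in A) \sum_(v in ~: A)
    weight G u v * (1 - (-1) ^+ (u \in A) * (-1) ^+ (v \in A)) =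
    2 * cut_weight G A.
  rewrite /cut_weight mulr_sumr; apply: eq_bigr => u uA; rewrite mulr_sumr.
  by apply: eq_bigr => v; rewrite inE uA => /negPf ->; ring.
have -> : \sum_(u in ~: A) \sum_(v in A)
    weight G u v * (1 - (-1) ^+ (u \in A) * (-1) ^+ (v \in A)) =
    2 * cut_weight G A.
  rewrite /cut_weight exchange_big mulr_sumr /=; apply: eq_bigr => u uA.
  rewrite mulr_sumr; apply: eq_bigr => v.
  by rewrite inE uA weight_sym => /negPf ->; ring.
by field.
Qed.

Lemma cut_le_maxcut (A : {set V}) : cut_weight G A <= maxcut G.
Proof. exact: le_bigmax. Qed.

Lemma maxcut_attained : exists A : {set V}, maxcut G = cut_weight G A.
Proof.
rewrite /maxcut; elim/big_ind: _ => [|x y [A ->] [B ->]|A _].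
- by exists finset.set0; rewrite /cut_weight big_set0.
- by rewrite /Num.max; case: ifP; [exists B | exists A].
- by exists A.
Qed.

(** The energy of y y^T is affine in each coordinate of y because a vertex has no
    edge to itself; hence each coordinate in turn can be pushed to 1 or -1
    without decreasing it. *)
Lemma energy_rank1_le_maxcut (y : V -> R) :
  (forall u, -1 <= y u <= 1) -> energy G (rank1 y) <= maxcut G.
Proof.
suff rounding (s : seq V) : forall z : V -> R, (forall u, -1 <= z u <= 1) ->
    (forall u, u \notin s -> z u = 1 \/ z u = -1) ->
    energy G (rank1 z) <= maxcut G.
  move=> y_bd; apply: (rounding (enum V)) => // u.
  by rewrite mem_enum.
elim: s => [|a s IHs] z z_bd z_sign.
  suff -> : rank1 z = rank1 (sign_vector R [set u | z u == -1]).
    by rewrite energy_sign_vector cut_le_maxcut.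
  rewrite [in LHS](_ : z = sign_vector R [set u | z u == -1]) //.
  apply/funext => u; rewrite /sign_vector inE.
  have [->|->] := z_sign u isT; last by rewrite eqxx.
  by rewrite (_ : (1 == -1 :> R) = false) //; apply/eqP; lra.
pose z1 e u := if u == a then e else z u.
have bd1 e : e = 1 \/ e = -1 -> energy G (rank1 (z1 e)) <= maxcut G.
  move=> he; apply: IHs => u; rewrite /z1; case: eqVneq => // nua.
  - by case: he => ->; lra.
  - move=> us; apply: z_sign; by rewrite inE negb_or nua.
(* z a is the convex combination of 1 and -1 with coefficients (1 + z a) / 2
   and (1 - z a) / 2. *)
have -> : energy G (rank1 z) = (1 + z a) / 2 * energy G (rank1 (z1 1))
    + (1 - z a) / 2 * energy G (rank1 (z1 (-1))).
  rewrite /energy [X in _ = X + _]mulrCA [X in _ = _ + X]mulrCA -mulrDr; congr (_ * _).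
  rewrite !mulr_sumr -big_split; apply: eq_bigr => u _ /=.
  rewrite !mulr_sumr -big_split; apply: eq_bigr => v _ /=.
  have [->|nuv] := eqVneq u v; first by rewrite weight_irr; ring.
  rewrite /rank1 /z1; case: (eqVneq u a) => [eu|_]; case: (eqVneq v a) => [ev|_].
  - by rewrite eu ev eqxx in nuv.
  - by rewrite eu; field.
  - by rewrite ev; field.
  - by field.
have := bd1 1 (or_introl erefl); have := bd1 (-1) (or_intror erefl).
have /andP[h1 h2] := z_bd a; nra.
Qed.

End Energy.

(** * Exactness in terms of kernels *)

Section Exactness.
Variables (R : realType) (V : finType) (G : wgraph R V).

Lemma sdp_objective_energy (X : 'M[R]_#|V|) : (forall i, X i i = 1) -> X^T = X ->
  sdp_objective G X = energy G (fun u v => X (enum_rank u) (enum_rank v)).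
Proof.
move=> diagX symX; rewrite /sdp_objective /energy; congr (_ * _).
have lapE (i j : 'I_#|V|) : laplacian G i j =
    (i == j)%:R * \sum_(k < #|V|) weight G (enum_val i) (enum_val k)
    - weight G (enum_val i) (enum_val j).
  rewrite mxE; case: eqVneq => [->|_]; last by rewrite mul0r sub0r.
  rewrite mul1r weight_irr subr0 [RHS](bigD1 j) //= weight_irr add0r //.
have -> : \tr (laplacian G *m X) =
    \sum_(i < #|V|) \sum_(j < #|V|) laplacian G i j * X j i.
  by apply: eq_bigr => i _; rewrite mxE.
rewrite [RHS](reindex (fun i : 'I_#|V| => enum_val i)) /=; last first.
  by apply: onW_bij; exact: enum_val_bij.
apply: eq_bigr => i _.
under eq_bigr => j _ do rewrite lapE mulrBl.
rewrite sumrB (bigD1 i) //= [X in _ + X - _]big1 ?addr0; last first.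
  by move=> j /negPf nji; rewrite eq_sym nji !mul0r.
rewrite eqxx diagX mulr1 mul1r -sumrB.
rewrite [RHS](reindex (fun i : 'I_#|V| => enum_val i)) /=; last first.
  by apply: onW_bij; exact: enum_val_bij.
apply: eq_bigr => j _; rewrite !enum_valK mulrBr mulr1; congr (_ - _ * _).
by rewrite -[in LHS]symX mxE.
Qed.

Lemma feasible_correlation (X : 'M[R]_#|V|) : sdp_feasible X ->
  correlation (fun u v => X (enum_rank u) (enum_rank v)).
Proof.
move=> [symX diagX posX]; split=> [|u]; last exact: diagX.
split=> [u v|f]; first by rewrite -[in LHS]symX mxE.
suff -> : \sum_u \sum_v f u * X (enum_rank u) (enum_rank v) * f v =
    ((\col_i f (enum_val i))^T *m X *m (\col_i f (enum_val i))) 0 0.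
  exact: posX.
rewrite mxE exchange_big (reindex (fun i : 'I_#|V| => enum_val i)) /=; last first.
  by apply: onW_bij; exact: enum_val_bij.
apply: eq_bigr => j _; rewrite !mxE mulr_suml.
rewrite (reindex (fun i : 'I_#|V| => enum_val i)) /=; last first.
  by apply: onW_bij; exact: enum_val_bij.
by apply: eq_bigr => i _; rewrite !mxE !enum_valK.
Qed.

Lemma correlation_feasible (K : V -> V -> R) : correlation K ->
  sdp_feasible (\matrix_(i, j) K (enum_val i) (enum_val j)).
Proof.
move=> [[symK posK] diagK]; split=> [|i|v].
- by apply/matrixP => i j; rewrite !mxE symK.
- by rewrite mxE.
suff -> : (v^T *m (\matrix_(i, j) K (enum_val i) (enum_val j)) *m v) 0 0 =
    \sum_a \sum_b v (enum_rank a) 0 * K a b * v (enum_rank b) 0 by exact: posK.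
rewrite mxE exchange_big [RHS](reindex (fun i : 'I_#|V| => enum_val i)) /=; last first.
  by apply: onW_bij; exact: enum_val_bij.
apply: eq_bigr => j _; rewrite !mxE mulr_suml.
rewrite [RHS](reindex (fun i : 'I_#|V| => enum_val i)) /=; last first.
  by apply: onW_bij; exact: enum_val_bij.
by apply: eq_bigr => i _; rewrite !mxE !enum_valK.
Qed.

Lemma energy_feasible (K : V -> V -> R) : correlation K ->
  sdp_objective G (\matrix_(i, j) K (enum_val i) (enum_val j)) = energy G K.
Proof.
move=> corK; have [symX diagX _] := correlation_feasible corK.
rewrite sdp_objective_energy //; congr (energy G _).
by apply/funext => u; apply/funext => v; rewrite mxE !enum_rankK.
Qed.

Lemma correlation_sign_vector (A : {set V}) :
  correlation (rank1 (sign_vector R A)).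
Proof.
split=> [|u]; first exact: psd_rank1.
by rewrite /rank1 /sign_vector -expr2 sqrr_sign.
Qed.

(** The maximum cut is itself an objective value, so the supremum equals it as
    soon as it bounds every feasible value.  Conversely a supremum bounds the
    set only if the set is bounded, which holds as entries of correlations lie
    in [-1, 1]. *)
Lemma exact_energyP :
  exact G <-> forall K, correlation K -> energy G K <= maxcut G.
Proof.
have [A maxA] := maxcut_attained G.
have in_sdp K : correlation K -> [set sdp_objective G X | X in
    sdp_feasible (R:=R) (V:=V)]%classic (energy G K).
  move=> corK; exists (\matrix_(i, j) K (enum_val i) (enum_val j)).
    exact: correlation_feasible.
  exact: energy_feasible.
have max_in : [set sdp_objective G X | X in
    sdp_feasible (R:=R) (V:=V)]%classic (maxcut G).
  rewrite maxA -energy_sign_vector; apply: in_sdp.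
  exact: correlation_sign_vector.
split=> [exG K corK|bdG].
  rewrite -exG; apply: ub_le_sup; last exact: in_sdp.
  exists (4^-1 * \sum_u \sum_v `|weight G u v| * 2) => _ [X feasX <-].
  have [symX diagX _] := feasX.
  rewrite sdp_objective_energy // ler_wpM2l ?invr_ge0 //.
  apply: ler_sum => u _; apply: ler_sum => v _.
  have /andP[Xge Xle] := correlation_bounded u v (feasible_correlation feasX).
  have := ler_norm (weight G u v); have := normr_ge0 (weight G u v); nra.
apply/eqP; rewrite eq_le; apply/andP; split.
  apply: ge_sup; first by exists (maxcut G).
  move=> _ [X feasX <-]; have [symX diagX _] := feasX.
  by rewrite sdp_objective_energy //; apply/bdG/feasible_correlation.
apply: ub_le_sup => //; exists (maxcut G) => _ [X feasX <-].
have [symX diagX _] := feasX.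
by rewrite sdp_objective_energy //; apply/bdG/feasible_correlation.
Qed.

End Exactness.

(** * Optimality conditions at an optimal cut *)

Section LocalOptimality.
Variables (R : realType) (V : finType) (G : wgraph R V) (A : {set V}).
Let x := sign_vector R A.

Lemma energyE (K : V -> V -> R) : energy G K =
  4^-1 * (\sum_u \sum_v weight G u v - \sum_u \sum_v weight G u v * K u v).
Proof.
congr (_ * _); rewrite -sumrB; apply: eq_bigr => u _.
by rewrite -sumrB; apply: eq_bigr => v _; rewrite mulrBr mulr1.
Qed.

(** The weight of the edges at u cut by A, minus the weight of the edges at u
    that A leaves uncut. *)
Definition cut_excess (u : V) : R := - \sum_v weight G u v * rank1 x u v.

Lemma sum_cut_excess (f : V -> R) : \sum_u cut_excess u * f u =
  - \sum_u \sum_v weight G u v * rank1 x u v * ((f u + f v) / 2).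
Proof.
have flip : \sum_u \sum_v weight G u v * rank1 x u v * f v =
    \sum_u \sum_v weight G u v * rank1 x u v * f u.
  rewrite exchange_big; apply: eq_bigr => u _; apply: eq_bigr => v _ /=.
  by rewrite weight_sym /rank1 [x v * _]mulrC.
rewrite -(_ : \sum_u \sum_v weight G u v * rank1 x u v * f u / 2 +
    \sum_u \sum_v weight G u v * rank1 x u v * f v / 2 =
    \sum_u \sum_v weight G u v * rank1 x u v * ((f u + f v) / 2)); last first.
  rewrite -big_split; apply: eq_bigr => u _; rewrite -big_split.
  by apply: eq_bigr => v _ /=; field.
have half (g : V -> V -> R) :
    \sum_u \sum_v g u v / 2 = (\sum_u \sum_v g u v) / 2.
  by rewrite mulr_suml; apply: eq_bigr => u _; rewrite mulr_suml.
rewrite !half flip -splitr -sumrN.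
by apply: eq_bigr => u _; rewrite /cut_excess mulNr mulr_suml.
Qed.

Hypothesis x_max :
  forall K, correlation K -> energy G K <= energy G (rank1 x).

(** Dual feasibility of the cut, obtained without SDP duality: for small e the
    kernel e * Y u v + x_u x_v c_u c_v with c_u = sqrt (1 - e * Y u u) is a
    correlation, and comparing it with x x^T to first order in e gives the
    claim.  The error is under control because
    c_u c_v - 1 = - e (Y u u + Y v v) / 2 - (c_u - c_v)^2 / 2
    and c_u - c_v = O(e). *)
Lemma local_optimality (Y : V -> V -> R) : psd_kernel Y ->
  0 <= \sum_u \sum_v weight G u v * Y u v + \sum_u cut_excess u * Y u u.
Proof.
move=> psdY; have Y0 u : 0 <= Y u u := psd_ge0 u psdY.
set L := (X in 0 <= X).
pose C := \sum_u \sum_v `|weight G u v| * (Y u u - Y v v) ^+ 2 / 2.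
have C0 : 0 <= C.
  apply: sumr_ge0 => u _; apply: sumr_ge0 => v _.
  by rewrite divr_ge0 // mulr_ge0 // sqr_ge0.
pose T := \sum_u Y u u.
have T0 : 0 <= T by apply: sumr_ge0.
have YT u : Y u u <= T by rewrite /T (bigD1 u) //= lerDl sumr_ge0.
(* 3 / 4 keeps c_u >= 1 / 2, so that c_u + c_v >= 1 in the bound on c_u - c_v. *)
have perturb e : 0 < e -> e * (1 + T) <= 3 / 4 -> 0 <= L + e * C.
  move=> e0 eT.
  have eY u : 0 <= e * Y u u <= 3 / 4 by have := Y0 u; have := YT u; nra.
  pose c u := Num.sqrt (1 - e * Y u u).
  have c2 u : c u * c u = 1 - e * Y u u.
    by rewrite -expr2 sqr_sqrtr //; have := eY u; lra.
  have c0 u : 0 <= c u by exact: sqrtr_ge0.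
  have chalf u : 1 / 2 <= c u by have := c0 u; have := c2 u; have := eY u; nra.
  pose K u v := e * Y u v + rank1 (fun u => x u * c u) u v.
  have corK : correlation K.
    split; first by apply: psd_add (psd_rank1 _); apply: psd_scale => //; lra.
    move=> u; rewrite /K /rank1 mulrACA c2 -expr2 /x /sign_vector sqrr_sign; lra.
  have := x_max corK; rewrite !energyE ler_pM2l ?invr_gt0 // lerD2l lerN2 => le_xK.
  suff : 0 <= e * (L + e * C) by rewrite pmulr_rge0.
  apply: (@le_trans _ _ (\sum_u \sum_v weight G u v * K u v -
      \sum_u \sum_v weight G u v * rank1 x u v)); first by rewrite subr_ge0.
  have -> : e * (L + e * C) = \sum_u \sum_v (e * (weight G u v * Y u v) -
      e * (weight G u v * rank1 x u v * ((Y u u + Y v v) / 2)) +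
      e * (e * (`|weight G u v| * (Y u u - Y v v) ^+ 2 / 2))).
    rewrite /L sum_cut_excess /C !mulrDr mulrN !mulr_sumr.
    rewrite -sumrB -big_split; apply: eq_bigr => u _ /=.
    by rewrite !mulr_sumr -sumrB -big_split.
  rewrite -sumrB; apply: ler_sum => u _; rewrite -sumrB; apply: ler_sum => v _.
  have x2 : rank1 x u v * rank1 x u v = 1.
    by rewrite /rank1 mulrACA -!expr2 /x /sign_vector !sqrr_sign mulr1.
  have gap : (c u - c v) ^+ 2 <= e ^+ 2 * (Y u u - Y v v) ^+ 2.
    have -> : e ^+ 2 * (Y u u - Y v v) ^+ 2 = (c u - c v) ^+ 2 * (c u + c v) ^+ 2.
      rewrite -!exprMn -subr_sqr !expr2 !c2; ring.
    rewrite ler_peMr ?sqr_ge0 // exprn_ege1 //.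
    by have := chalf u; have := chalf v; lra.
  have -> : weight G u v * K u v - weight G u v * rank1 x u v =
      e * (weight G u v * Y u v) -
      e * (weight G u v * rank1 x u v * ((Y u u + Y v v) / 2)) -
      weight G u v * rank1 x u v * ((c u - c v) ^+ 2 / 2).
    have -> : (c u - c v) ^+ 2 = (1 - e * Y u u) + (1 - e * Y v v) - 2 * (c u * c v).
      by rewrite -!c2; ring.
    by rewrite /K /rank1; field.
  rewrite lerD2l.
  apply: (@le_trans _ _ (`|weight G u v| * ((c u - c v) ^+ 2 / 2))).
    rewrite -mulNr ler_wpM2r ?divr_ge0 ?sqr_ge0 //.
    apply: le_trans (ler_norm _) _; rewrite normrN normrM.
    by rewrite /rank1 normrM /x /sign_vector !normr_sign !mulr1.
  rewrite -!mulrA !(mulrCA e) ler_wpM2l ?normr_ge0 //; lra.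
rewrite leNgt; apply/negP => L0.
(* e0 is the largest admissible e; below e1 the term e * C cannot make up for
   L < 0. *)
pose e0 := (3 / 4) / (1 + T).
have e0T : e0 * (1 + T) = 3 / 4 by rewrite divfK //; apply/eqP; lra.
have e00 : 0 < e0 by rewrite divr_gt0 //; lra.
pose e1 := - L / (2 * (1 + C)).
have e1C : e1 * (1 + C) = - L / 2.
  rewrite /e1; field; apply/eqP; lra.
have e10 : 0 < e1 by rewrite divr_gt0 //; lra.
have lt0 : Num.min e0 e1 <= e0 by rewrite ge_min lexx.
have lt1 : Num.min e0 e1 <= e1 by rewrite ge_min lexx orbT.
have : 0 < Num.min e0 e1 by rewrite lt_min e00.
move: (Num.min e0 e1) lt0 lt1 => e le0 le1 e_gt0.
have : e * (1 + T) <= 3 / 4 by nra.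
by move=> /(perturb e e_gt0); nra.
Qed.

(** A psd matrix with a non-positive diagonal entry has a zero row there.  The
    matrix is the one of local_optimality, tested at the vector a e_u - e_v. *)
Lemma cut_excess_gt0 u v : 0 < weight G u v -> 0 < cut_excess u.
Proof.
move=> w0; rewrite ltNge; apply/negP => q0.
have nuv : (v == u) = false.
  by apply/eqP => e; move: w0; rewrite e weight_irr ltxx.
(* With this a the value at a e_u - e_v is a ^+ 2 * cut_excess u - 1. *)
pose a := (cut_excess v + 1) / (2 * weight G u v).
have := local_optimality (psd_rank1 (fun z => a * (z == u)%:R - (z == v)%:R)).
have pick (H : V -> R) :
    \sum_z H z * (a * (z == u)%:R - (z == v)%:R) = a * H u - H v.
  rewrite (bigD1 u) //= (bigD1 v) ?nuv //= big1; last first.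
    by move=> z /andP[/negPf -> /negPf ->]; rewrite mulr0 subr0 mulr0.
  by rewrite !eqxx [u == v]eq_sym nuv /=; ring.
have -> : \sum_y \sum_z weight G y z *
    rank1 (fun z => a * (z == u)%:R - (z == v)%:R) y z = - 2 * a * weight G u v.
  under eq_bigr => y _.
    under eq_bigr => z _ do rewrite /rank1 mulrCA mulrC.
    rewrite -mulr_suml pick; over.
  rewrite /= pick !weight_irr [weight G v u]weight_sym; ring.
have -> : \sum_y cut_excess y *
    rank1 (fun z => a * (z == u)%:R - (z == v)%:R) y y =
    a ^+ 2 * cut_excess u + cut_excess v.
  under eq_bigr => y _ do rewrite /rank1 mulrA.
  by rewrite pick !eqxx nuv [u == v]eq_sym nuv /=; ring.
have -> : - 2 * a * weight G u v = - (cut_excess v + 1).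
  by rewrite /a; field; apply/eqP; lra.
have := sqr_ge0 a; nra.
Qed.

(** With uniform weights the cut excess is w times an integer, so positivity
    improves to a gap of w; for w = 0 the claim is 0 <= 0. *)
Lemma cut_excess_ge_weight w u v : (forall s t, edge G s t -> weight G s t = w) ->
  0 <= w -> edge G u v -> w <= cut_excess u.
Proof.
move=> unif; rewrite le_eqVlt => /orP[/eqP w0 _|w0 uv].
  rewrite -w0 /cut_excess big1 ?oppr0 // => z _.
  have [/unif ->|/weight_nonedge ->] := boolP (edge G u z).
    by rewrite -w0 mul0r.
  by rewrite mul0r.
pose n : int := \sum_z (edge G u z)%:R * - ((-1) ^+ (u \in A) * (-1) ^+ (z \in A)).
have qE : cut_excess u = w * n%:~R.
  rewrite /cut_excess /n rmorph_sum mulr_sumr -sumrN; apply: eq_bigr => z _ /=.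
  rewrite rmorphM rmorphN rmorphM !rmorph_sign /rank1 /x /sign_vector.
  have [/unif ->|/weight_nonedge ->] := boolP (edge G u z); rewrite /=; ring.
have := @cut_excess_gt0 u v; rewrite (unif _ _ uv) qE pmulr_rgt0 // => /(_ w0).
rewrite ltr0z => n0; rewrite -[leLHS]mulr1 ler_pM2l //.
by rewrite (ler_int R 1).
Qed.

End LocalOptimality.

(** * Splitting vertices and averaging over copies *)

Section Averaging.
Variables (R : realType) (V : finType) (m : V -> nat).
Hypothesis m_gt0 : forall i, (0 < m i)%N.

Definition copy i (k : 'I_(m i)) : split_vertex m := existT _ i k.

Lemma sum_split_vertex (F : split_vertex m -> R) :
  \sum_a F a = \sum_i \sum_(k < m i) F (copy k).
Proof.
rewrite sig_big_dep /=; apply: eq_bigr => -[i k] _ //.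
Qed.

Definition copy_average (K : split_vertex m -> split_vertex m -> R) i j : R :=
  (\sum_k \sum_l K (@copy i k) (@copy j l)) / ((m i)%:R * (m j)%:R).

Lemma energy_split (G : wgraph R V) K :
  energy (split_graph G m) K = energy G (copy_average K).
Proof.
rewrite /energy sum_split_vertex; congr (_ * _); apply: eq_bigr => i _.
under eq_bigr => k _ do rewrite sum_split_vertex.
rewrite exchange_big; apply: eq_bigr => j _ /=.
have mi0 : (m i)%:R != 0 :> R by rewrite pnatr_eq0 -lt0n.
have mj0 : (m j)%:R != 0 :> R by rewrite pnatr_eq0 -lt0n.
rewrite /split_weight /=.
under eq_bigr => k _ do rewrite -mulr_sumr sumrB sumr_const card_ord.
rewrite -mulr_sumr sumrB sumr_const card_ord /copy_average.
by rewrite -[1 *+ _ *+ _]mulr_natr; field; rewrite mi0 mj0.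
Qed.

Lemma copy_average_pullback (K : V -> V -> R) :
  copy_average (fun a b => K (tag a) (tag b)) = K.
Proof.
apply/funext => i; apply/funext => j; rewrite /copy_average /=.
have mi0 : (m i)%:R != 0 :> R by rewrite pnatr_eq0 -lt0n.
have mj0 : (m j)%:R != 0 :> R by rewrite pnatr_eq0 -lt0n.
under eq_bigr => k _ do rewrite sumr_const card_ord.
rewrite sumr_const card_ord -[_ *+ _ *+ _]mulr_natr -[K i j *+ _]mulr_natr.
by field; rewrite mi0 mj0.
Qed.

Lemma copy_average_le1 (K : split_vertex m -> split_vertex m -> R) i j :
  (forall a b, K a b <= 1) -> copy_average K i j <= 1.
Proof.
move=> K1; rewrite ler_pdivrMr ?mulr_gt0 ?ltr0n // mul1r.
apply: (@le_trans _ _ (\sum_(k < m i) \sum_(l < m j) 1)).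
  by apply: ler_sum => k _; apply: ler_sum => l _.
under eq_bigr => k _ do rewrite sumr_const card_ord.
by rewrite sumr_const card_ord -[1 *+ _ *+ _]mulr_natr mulrC.
Qed.

Lemma copy_average_rank1 (f : split_vertex m -> R) :
  copy_average (rank1 f) = rank1 (fun i => (\sum_k f (@copy i k)) / (m i)%:R).
Proof.
apply/funext => i; apply/funext => j; rewrite /copy_average /rank1.
by rewrite -big_distrlr /= invfM mulrACA.
Qed.

(** A cut of the split graph averages to a vector with entries in [-1, 1], which
    is then rounded. *)
Lemma maxcut_split_le (G : wgraph R V) : maxcut (split_graph G m) <= maxcut G.
Proof.
have [A ->] := maxcut_attained (split_graph G m).
rewrite -energy_sign_vector energy_split copy_average_rank1.
apply: energy_rank1_le_maxcut => i.
rewrite ler_pdivlMr ?ltr0n // ler_pdivrMr ?ltr0n // mulN1r mul1r.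
have sign_bd a : -1 <= sign_vector R A a <= 1.
  by rewrite /sign_vector; case: (a \in A); rewrite ?expr0 ?expr1; lra.
have cst (c : R) : c * (m i)%:R = \sum_(k < m i) c.
  by rewrite sumr_const card_ord mulr_natr.
rewrite -mulN1r -[X in _ && (_ <= X)]mul1r !cst; apply/andP.
by split; apply: ler_sum => k _; have /andP[] := sign_bd (copy k).
Qed.

End Averaging.

Lemma psd_copy_average (R : realType) (V U : finType) (p : nat)
    (h : split_vertex (fun _ : U => p) -> V) (K : V -> V -> R) :
  psd_kernel K -> psd_kernel (copy_average (fun a b => K (h a) (h b))).
Proof.
move=> psdK.
have -> : copy_average (fun a b => K (h a) (h b)) = fun s t =>
    (p%:R * p%:R)^-1 * \sum_k \sum_l
      K (h (@copy U (fun=> p) s k)) (h (@copy U (fun=> p) t l)).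
  by apply/funext => s; apply/funext => t; rewrite mulrC.
apply: psd_scale; first by rewrite invr_ge0 mulr_ge0.
exact: (@psd_block_sum _ _ _ _ (fun s k => h (@copy U (fun=> p) s k))).
Qed.

(** * Exact skeletons have slack at non-isolated vertices *)

Definition nonisolated (R : realType) (V : finType) (G : wgraph R V) : pred V :=
  fun u => [exists v, edge G u v].

(** By local_optimality, energy S Y falls short of the maximum cut by at least
    1/4 * sum_s q_s * (1 - Y s s), q being the cut excess of a maximum cut; and
    q_s >= w at every vertex that has an edge. *)
Lemma exact_uniform_slack (R : realType) (U : finType) (S : wgraph R U) (w : R)
    (Y : U -> U -> R) :
  exact S -> (forall s t, edge S s t -> weight S s t = w) ->
  (forall s t, edge S s t -> 0 <= w) ->
  psd_kernel Y -> (forall s, Y s s <= 1) ->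
  energy S Y + 4^-1 * \sum_s w * (nonisolated S s)%:R * (1 - Y s s) <= maxcut S.
Proof.
move=> /exact_energyP exS unif w0 psdY Y1.
have [A maxA] := maxcut_attained S.
have x_max K : correlation K ->
    energy S K <= energy S (rank1 (sign_vector R A)).
  by rewrite energy_sign_vector -maxA; exact: exS.
have := local_optimality x_max psdY.
rewrite maxA -energy_sign_vector !energyE -mulrDr ler_pM2l ?invr_gt0 //.
have q_ge s : w * (nonisolated S s)%:R * (1 - Y s s) <=
    cut_excess S A s * 1 - cut_excess S A s * Y s s.
  rewrite mulr1 -[X in _ <= X - _]mulr1 -mulrBr ler_wpM2r ?subr_ge0 //.
  rewrite /nonisolated; case: existsP => [[t st]|iso].
    by rewrite mulr1; apply: (cut_excess_ge_weight x_max unif (w0 _ _ st) st).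
  rewrite mulr0 /cut_excess big1 ?oppr0 // => t _.
  rewrite weight_nonedge ?mul0r //; apply/negP => st; case: iso; by exists t.
have : \sum_s w * (nonisolated S s)%:R * (1 - Y s s) <=
    \sum_s cut_excess S A s * 1 - \sum_s cut_excess S A s * Y s s.
  by rewrite -sumrB; apply: ler_sum.
have -> : \sum_s cut_excess S A s * 1 =
    - \sum_s \sum_t weight S s t * rank1 (sign_vector R A) s t.
  by rewrite -sumrN; apply: eq_bigr => s _; rewrite mulr1.
lra.
Qed.

(** * Transfer along a split decomposition *)

Section Decomposition.
Variables (R : realType) (V U : finType) (G : wgraph R V) (S : wgraph R U).
Hypothesis G_nonneg : nonneg_weights G.
Variable D : split_decomposition G S.

Let p := sd_p D.
Let w := sd_w D.
Let g := sd_iso D.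
Let Gt := split_graph G (sd_mult D).
Let St := split_graph S (fun _ => p).

Let p_gt0 (s : U) : (0 < p)%N.
Proof. exact: ltnW (sd_p_ge2 D). Qed.

Let pR_gt0 : 0 < p%:R :> R.
Proof. by rewrite ltr0n; exact: ltnW (sd_p_ge2 D). Qed.

Let energy_along_iso (K : split_vertex (sd_mult D) -> split_vertex (sd_mult D) -> R) :
  energy Gt K = 4^-1 * \sum_a \sum_b weight Gt (g a) (g b) * (1 - K (g a) (g b)).
Proof.
have [g_bij _ _] := sd_isoP D.
rewrite /energy (reindex g) /=; last exact: onW_bij.
by congr (_ * _); apply: eq_bigr => a _; rewrite (reindex g) //; exact: onW_bij.
Qed.

Lemma split_weight_ge0 a b : 0 <= weight Gt a b.
Proof.
rewrite /= /split_weight divr_ge0 ?mulr_ge0 //.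
have [/G_nonneg //|/weight_nonedge -> //] := boolP (edge G (tag a) (tag b)).
Qed.

Lemma skeleton_weight a b : edge St a b ->
  weight Gt (g a) (g b) = weight St a b /\ weight St a b = w / p%:R ^+ 2.
Proof.
move=> ab; have [_ gE gW] := sd_isoP D.
have [_ eW] := @sd_spanning _ _ _ _ _ D (g a) (g b) (etrans (gE a b) ab).
split; first by rewrite -eW gW.
by rewrite /= /split_weight (@sd_uniform _ _ _ _ _ D) // expr2.
Qed.

(** The sign of w comes from G: as p > 0, every edge of S has a copy in the split
    graph of G, where weights are non-negative. *)
Lemma skeleton_weight_ge0 s t : edge S s t -> 0 <= w.
Proof.
move=> st; pose k : 'I_p := Ordinal (p_gt0 s).
have [e1 e2] : weight Gt (g (@copy _ (fun=> p) s k)) (g (@copy _ (fun=> p) t k)) =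
    weight St (@copy _ (fun=> p) s k) (@copy _ (fun=> p) t k) /\ 
    weight St (@copy _ (fun=> p) s k) (@copy _ (fun=> p) t k) = w / p%:R ^+ 2.
  exact: skeleton_weight.
have : 0 <= w / p%:R ^+ 2 by rewrite -e2 -e1 split_weight_ge0.
by rewrite pmulr_lge0 // invr_gt0 exprn_gt0.
Qed.

Lemma split_skeleton_weight_le a b : weight St a b <= weight Gt (g a) (g b).
Proof.
have [/skeleton_weight[-> _] //|/weight_nonedge ->] := boolP (edge St a b).
exact: split_weight_ge0.
Qed.

(** The lifted cut is constant on the copies of each vertex of S; the residual
    edges can only add weight to it. *)
Lemma maxcut_skeleton_le : maxcut S <= maxcut G.
Proof.
apply: le_trans (maxcut_split_le (@sd_mult_gt0 _ _ _ _ _ D) G).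
have [A ->] := maxcut_attained S.
have [[g' gK g'K] _ _] := sd_isoP D.
rewrite -energy_sign_vector -(copy_average_pullback p_gt0 (rank1 _)) -energy_split //.
pose B : {set split_vertex (sd_mult D)} := [set c | tag (g' c) \in A].
apply: le_trans (cut_le_maxcut _ B).
rewrite -energy_sign_vector energy_along_iso /energy ler_pM2l ?invr_gt0 //.
apply: ler_sum => a _; apply: ler_sum => b _.
rewrite /rank1 /sign_vector !inE !gK.
apply: ler_wpM2r; last exact: split_skeleton_weight_le.
by case: (_ \in A); case: (_ \in A); rewrite ?expr0 ?expr1; lra.
Qed.

Hypothesis D_nonisolated : residual_nonisolated D.

(** The right-hand side charges w / p^2 to every ordered pair of copies of a
    non-isolated skeleton vertex, residual or not.  The diagonal pairs are
    harmless because c, to be 1 - K, vanishes there. *)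
Lemma split_weight_bound a b (c : R) : 0 <= c -> (a = b -> c = 0) ->
  weight Gt (g a) (g b) * c <= weight St a b * c +
    w / p%:R ^+ 2 * ((tag a == tag b)%:R * (nonisolated S (tag a))%:R) * c.
Proof.
move=> c0 cab; have [-> |c_neq0] := eqVneq c 0; first by rewrite !mulr0 addr0.
have w0 : 0 <= w / p%:R ^+ 2 * ((tag a == tag b)%:R * (nonisolated S (tag a))%:R).
  case: (boolP (nonisolated S (tag a))) => [/existsP[t st]|_]; last by rewrite !mulr0.
  rewrite mulr_ge0 ?divr_ge0 ?exprn_ge0 ?mulr_ge0 //.
  exact: skeleton_weight_ge0 st.
rewrite -mulrDl ler_wpM2r //.
have [/skeleton_weight[-> _]|nab] := boolP (edge St a b); first by rewrite lerDl.
rewrite [weight St a b]weight_nonedge // add0r.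
have [gab|/weight_nonedge -> //] := boolP (edge Gt (g a) (g b)).
have [_ gE _] := sd_isoP D.
have res : residual Gt (sd_graph D) (g a) (g b) by rewrite /residual gab gE.
rewrite (sd_residual_block res) eqxx -(sd_residual_block res).
have [t st] := D_nonisolated res.
have -> : nonisolated S (tag a) by apply/existsP; exists t.
by rewrite !mulr1; exact: sd_residual_weight res.
Qed.

Definition skeleton_average (K : V -> V -> R) : U -> U -> R :=
  copy_average (fun a b => K (tag (g a)) (tag (g b))).

(** Summed over the p^2 ordered pairs of copies of s, the values 1 - K give
    p^2 * (1 - Y s s), with Y the average of K. *)
Lemma decomposition_energy_le (K : V -> V -> R) : correlation K ->
  energy G K <= energy S (skeleton_average K) +
    4^-1 * \sum_s w * (nonisolated S s)%:R * (1 - skeleton_average K s s).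
Proof.
move=> corK; set Y := skeleton_average K.
rewrite -[X in energy G X](copy_average_pullback (@sd_mult_gt0 _ _ _ _ _ D)).
rewrite -energy_split; last exact: sd_mult_gt0.
rewrite energy_along_iso /Y /skeleton_average -energy_split //.
rewrite -/(skeleton_average K) -/Y -mulrDr ler_pM2l ?invr_gt0 //.
pose K' (a b : split_vertex (fun _ : U => p)) := K (tag (g a)) (tag (g b)).
have -> : \sum_s w * (nonisolated S s)%:R * (1 - Y s s) =
    \sum_a \sum_b w / p%:R ^+ 2 *
      ((tag a == tag b)%:R * (nonisolated S (tag a))%:R) * (1 - K' a b).
  rewrite sum_split_vertex; apply: eq_bigr => s _.
  under [RHS]eq_bigr => k _.
    rewrite sum_split_vertex (bigD1 s) //= [X in _ + X]big1 ?addr0; last first.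
      by move=> t /negPf ts; apply: big1 => l _; rewrite eq_sym ts mul0r mulr0 mul0r.
    rewrite eqxx mul1r -mulr_sumr sumrB sumr_const card_ord; over.
  rewrite /= -mulr_sumr sumrB sumr_const card_ord /Y /skeleton_average /copy_average /K'.
  by rewrite -[1 *+ _ *+ _]mulr_natr; field; rewrite gt_eqF.
rewrite -big_split; apply: ler_sum => a _; rewrite -big_split.
apply: ler_sum => b _; apply: split_weight_bound => [|->].
  by rewrite subr_ge0; have /andP[] := correlation_bounded (tag (g a)) (tag (g b)) corK.
by have [_ ->] := corK; rewrite subrr.
Qed.

End Decomposition.

(** * Exactness of the decomposed graph *)

Theorem proposition15 (R : realType) (V U : finType)
    (G : wgraph R V) (S : wgraph R U)
    (G_nonneg : nonneg_weights G)
    (D : split_decomposition G S)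
    (D_nonisolated : residual_nonisolated D)
    (S_exact : exact S) :
  exact G.
Proof.
apply/exact_energyP => K corK.
apply: le_trans (maxcut_skeleton_le G_nonneg D).
apply: le_trans (decomposition_energy_le G_nonneg D_nonisolated corK) _.
apply: exact_uniform_slack => //.
- exact: sd_uniform.
- by move=> s t; exact: skeleton_weight_ge0.
- by case: corK => psdK _; exact: psd_copy_average.
move=> s; apply: copy_average_le1 => [_|a b]; first exact: ltnW (sd_p_ge2 D).
by have /andP[] := correlation_bounded (tag (sd_iso D a)) (tag (sd_iso D b)) corK.
Qed.
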